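(* Let $\lambda\in\mathbb C$ and $k\in\mathbb N$. Then $$j^{(k)}_\lambda(\xi)=B_k^{\lambda-\frac n2}(i\xi).$$
   Context: On $\mathbb R^n$ write $x=(x',x_n)$ with $x'\in\mathbb R^{n-1}$. For $\lambda\in\mathbb C$ let $E_\lambda=x_n\Delta+(2\lambda-n+2)\frac{\partial}{\partial x_n}$, with $\Delta=\sum_{j=1}^n\frac{\partial^2}{\partial x_j^2}$. Let $\mathrm{res}:C^\infty(\mathbb R^n)\to C^\infty(\mathbb R^{n-1})$, $\mathrm{res}(f)(x')=f(x',0)$, and $J^{(k)}_\lambda=\mathrm{res}\circ E_{\lambda+k-1}\circ\dots\circ E_\lambda$ (with $J^{(0)}_\lambda=\mathrm{res}$), the Juhl operators. $J^{(k)}_\lambda$ has constant coefficients, and its symbol $j^{(k)}_\lambda$ is the polynomial on $\mathbb R^n$ with $J^{(k)}_\lambda(e^{ix.\xi})(x')=j^{(k)}_\lambda(\xi)e^{ix'.\xi'}$, where $\xi=(\xi',\xi_n)$. For $\gamma\in\mathbb C$, the polynomials $B_k^\gamma$ on $\mathbb R^n$ (extended to complex arguments) are defined by $B_0^\gamma=1$ and, for $\xi\ne0$, $$\left(\frac{\partial}{\partial\xi_n}\right)^k|\xi|^{2(\gamma+k)}=B_k^\gamma(\xi)\,|\xi|^{2\gamma}.$$ *)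

(* Defs.v *)
From HB Require Import structures.
From mathcomp Require Import all_boot all_order all_algebra.
From mathcomp Require Import all_classical all_reals all_analysis.
From mathcomp Require Import complex.
From mathcomp Require Import ring.
(* The notations of mpoly clash with those of the analysis library. *)
From mathcomp Require Import -(notations) mpoly.

Set Implicit Arguments.
Unset Strict Implicit.
Unset Printing Implicit Defensive.

Import Order.TTheory GRing.Theory Num.Theory.
Import numFieldNormedType.Exports.
Local Open Scope classical_set_scope.
Local Open Scope ring_scope.
Local Open Scope complex_scope.

(* The ambient space is 'rV[R]_m.+1 (so n = m.+1); the distinguished coordinate
   x_n is [x 0 ord_max] and x' is [hproj x]. *)
Section Juhl.
Variables (R : realType) (m : nat).

Local Notation cmpoly := (mpoly m.+1 R[i]).

Definition cexp (z : R[i]) : R[i] :=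
  (expR (complex.Re z) * cos (complex.Im z))
  +i* (expR (complex.Re z) * sin (complex.Im z)).

(* r^z with the real logarithm; only meaningful for 0 < r. *)
Definition cpow (r : R) (z : R[i]) : R[i] := cexp (z * (ln r)%:C).

(* The library norm on row vectors is the sup norm. *)
Definition eucl_norm n (x : 'rV[R]_n) : R := Num.sqrt (\sum_i x 0 i ^+ 2).

Definition dotv n (x y : 'rV[R]_n) : R := \sum_i x 0 i * y 0 i.

Definition plane_wave n (xi : 'rV[R]_n) (x : 'rV[R]_n) : R[i] :=
  cexp ('i * (dotv x xi)%:C).

(* R[i] carries no normed module structure over R in the library, so
   derivatives are taken on real and imaginary parts. As ['D_v] is total, the
   operators below are defined on all functions; on smooth functions they are
   the classical ones. *)
Definition pderiv (j : 'I_m.+1) (f : 'rV[R]_m.+1 -> R[i]) (x : 'rV[R]_m.+1)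
    : R[i] :=
  ('D_(delta_mx 0 j) (@complex.Re R \o f) x)
  +i* ('D_(delta_mx 0 j) (@complex.Im R \o f) x).

Definition laplacian (f : 'rV[R]_m.+1 -> R[i]) (x : 'rV[R]_m.+1) : R[i] :=
  \sum_j pderiv j (pderiv j f) x.

Definition juhlE (lambda : R[i]) (f : 'rV[R]_m.+1 -> R[i]) (x : 'rV[R]_m.+1)
    : R[i] :=
  (x 0 ord_max)%:C * laplacian f x
  + (2 * lambda - m.+1%:R + 2) * pderiv ord_max f x.

Definition hproj (x : 'rV[R]_m.+1) : 'rV[R]_m := \row_j x 0 (lift ord_max j).

Definition hincl (x' : 'rV[R]_m) : 'rV[R]_m.+1 :=
  \row_i oapp (fun j => x' 0 j) 0 (unlift ord_max i).

Definition res (f : 'rV[R]_m.+1 -> R[i]) (x' : 'rV[R]_m) : R[i] := f (hincl x').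

Fixpoint juhlE_iter (lambda : R[i]) (k : nat) (f : 'rV[R]_m.+1 -> R[i])
    : 'rV[R]_m.+1 -> R[i] :=
  if k is k'.+1 then juhlE (lambda + k'%:R) (juhlE_iter lambda k' f) else f.

Definition juhlJ (lambda : R[i]) (k : nat) (f : 'rV[R]_m.+1 -> R[i])
    : 'rV[R]_m -> R[i] :=
  res (juhlE_iter lambda k f).

Definition is_juhl_symbol (lambda : R[i]) (k : nat) (p : cmpoly) : Prop :=
  forall (xi : 'rV[R]_m.+1) (x' : 'rV[R]_m),
    juhlJ lambda k (plane_wave xi) x'
    = meval (fun i => (xi 0 i)%:C) p * plane_wave (hproj xi) x'.

(* [juhl_symbolP] and [juhl_symbol_uniq] below show that this picks the unique
   polynomial satisfying [is_juhl_symbol]. *)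
Definition juhl_symbol (lambda : R[i]) (k : nat) : cmpoly :=
  xget (0 : cmpoly) [set p | is_juhl_symbol lambda k p].

Definition is_Bpoly (gamma : R[i]) (k : nat) (p : cmpoly) : Prop :=
  forall xi : 'rV[R]_m.+1, xi != 0 ->
    iter k (pderiv ord_max)
      (fun eta => cpow (eucl_norm eta) (2 * (gamma + k%:R))) xi
    = meval (fun i => (xi 0 i)%:C) p * cpow (eucl_norm xi) (2 * gamma).

(* See [BpolyP] and [Bpoly_uniq] below for existence and uniqueness. *)
Definition Bpoly (gamma : R[i]) (k : nat) : cmpoly :=
  xget (0 : cmpoly) [set p | is_Bpoly gamma k p].

End Juhl.

Section Facts.
Variables (R : realType) (m : nat).
Local Notation C := R[i].
Local Notation V := 'rV[R]_m.+1.
Implicit Types (f g : V -> C) (x xi : V) (j : 'I_m.+1).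

Definition is_pderiv j f x (v : C) : Prop :=
  is_derive x (delta_mx 0 j : V) (@complex.Re R \o f) (complex.Re v) /\
  is_derive x (delta_mx 0 j : V) (@complex.Im R \o f) (complex.Im v).

Lemma is_pderivE j f x v : is_pderiv j f x v -> pderiv j f x = v.
Proof. by case=> [[_ h1] [_ h2]]; rewrite /pderiv h1 h2; case: v {h1 h2}. Qed.

Lemma is_pderiv_eq j f x v w : is_pderiv j f x v -> v = w -> is_pderiv j f x w.
Proof. by move=> ? <-. Qed.

Lemma is_pderiv_near j f g x v :
  (\near x, f x = g x) -> is_pderiv j f x v -> is_pderiv j g x v.
Proof.
move=> fg [h1 h2]; split; [move: h1|move: h2]; apply: near_eq_is_derive;
  by near=> y; rewrite /=; congr (_ _); near: y.
Unshelve. all: by end_near. Qed.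

Lemma is_pderiv_cst j (c : C) x : is_pderiv j (fun=> c) x 0.
Proof. by split; exact: is_derive_cst. Qed.

Lemma is_pderivD j f g x v w : is_pderiv j f x v -> is_pderiv j g x w ->
  is_pderiv j (fun y => f y + g y) x (v + w).
Proof.
move=> [f1 f2] [g1 g2]; split.
  rewrite raddfD /= (_ : _ \o _ = (@complex.Re R \o f) \+ (@complex.Re R \o g)).
    exact: is_deriveD.
  by apply/funext => y /=; rewrite raddfD.
rewrite raddfD /= (_ : _ \o _ = (@complex.Im R \o f) \+ (@complex.Im R \o g)).
  exact: is_deriveD.
by apply/funext => y /=; rewrite raddfD.
Qed.

Lemma is_pderivM j f g x v w : is_pderiv j f x v -> is_pderiv j g x w ->
  is_pderiv j (fun y => f y * g y) x (v * g x + f x * w).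
Proof.
move=> [f1 f2] [g1 g2]; split.
  rewrite (_ : _ \o _ = (@complex.Re R \o f) * (@complex.Re R \o g)
                       - (@complex.Im R \o f) * (@complex.Im R \o g)); last first.
    by apply/funext => y; rewrite /= !fctE /=; case: (f y) (g y) => [a b] [c d].
  apply: is_derive_eq.
  rewrite /= /GRing.scale/=; move: (f x) (g x) v w {f1 f2 g1 g2} => [a b] [c d] [e h] [k l] /=; ring.
rewrite (_ : _ \o _ = (@complex.Re R \o f) * (@complex.Im R \o g)
                       + (@complex.Im R \o f) * (@complex.Re R \o g)); last first.
  by apply/funext => y; rewrite /= !fctE /=; case: (f y) (g y) => [a b] [c d].
apply: is_derive_eq.
rewrite /= /GRing.scale/=; move: (f x) (g x) v w {f1 f2 g1 g2} => [a b] [c d] [e h] [k l] /=; ring.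
Qed.

Lemma is_derive_line (q : V -> R) x (v : V) b :
  is_derive (0 : R) 1 (fun h => q (h *: v + x)) b <-> is_derive x v q b.
Proof.
have E : (fun h : R => h^-1 *: ((((fun h => q (h *: v + x)) \o shift (0:R)) (h *: (1:R)) - (fun h => q (h *: v + x)) 0))) = (fun h : R => h^-1 *: ((q \o shift x) (h *: v) - q x)).
  apply/funext => h /=; congr (_ *: _).
  by rewrite addr0 scale0r add0r [X in q (X *: _ + _)]mulr1.
by split=> -[]; rewrite /derivable /derive => h1 h2; apply: DeriveDef;
  rewrite /derivable /derive; move: h1 h2; rewrite E.
Qed.

Lemma is_derive_coord i j x :
  is_derive x (delta_mx 0 j : V) (fun y : V => y 0 i) ((i == j)%:R : R).
Proof.
apply/is_derive_line.
rewrite (_ : (fun _ => _) = (fun h : R => h * (i == j)%:R + x 0 i)); last first.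
  by apply/funext => h; rewrite !mxE eqxx.
apply: is_derive_eq; rewrite /GRing.scale /=; ring.
Qed.

Lemma is_derive_comp1 (h : R -> R) (q : V -> R) x v a b :
  is_derive (q x) 1 h a -> is_derive x v q b -> is_derive x v (h \o q) (a * b).
Proof.
move=> h1 /is_derive_line h2; apply/is_derive_line.
by apply: (@is_derive1_comp _ h (fun t => q (t *: v + x))); rewrite /= ?scale0r ?add0r.
Qed.

Lemma is_pderiv_real j (q : V -> R) x b :
  is_derive x (delta_mx 0 j : V) q b -> is_pderiv j (fun y => (q y)%:C) x b%:C.
Proof. by move=> h; split => //=; exact: is_derive_cst. Qed.

Lemma is_pderiv_coord i j x :
  is_pderiv j (fun y => (y 0 i)%:C) x (i == j)%:R.
Proof.
apply: is_pderiv_eq (is_pderiv_real (is_derive_coord _ _ _)) _.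
by rewrite rmorph_nat.
Qed.

Lemma is_pderiv_cexp j f x v :
  is_pderiv j f x v -> is_pderiv j (fun y => cexp (f y)) x (v * cexp (f x)).
Proof.
move=> [f1 f2].
have e1 := is_derive_comp1 (is_derive_expR _) f1.
have c1 := is_derive_comp1 (is_derive_cos _) f2.
have s1 := is_derive_comp1 (is_derive_sin _) f2.
split.
  rewrite (_ : _ \o _ = (expR \o (@complex.Re R \o f)) * (cos \o (@complex.Im R \o f)));
    last by apply/funext.
  apply: is_derive_eq; rewrite /= /GRing.scale/= /cexp.
  case: v {f1 f2 e1 c1 s1} => a b /=; ring.
rewrite (_ : _ \o _ = (expR \o (@complex.Re R \o f)) * (sin \o (@complex.Im R \o f)));
  last by apply/funext.
apply: is_derive_eq; rewrite /= /GRing.scale/= /cexp.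
case: v {f1 f2 e1 c1 s1} => a b /=; ring.
Qed.

Lemma is_pderiv_sum (I : Type) (r : seq I) (F : I -> V -> C) (D : I -> C) j x :
  (forall i, is_pderiv j (F i) x (D i)) ->
  is_pderiv j (fun y => \sum_(i <- r) F i y) x (\sum_(i <- r) D i).
Proof.
move=> h; elim: r => [|a r IH].
  rewrite big_nil (_ : (fun _ => _) = fun=> 0); first exact: is_pderiv_cst.
  by apply/funext => y; rewrite big_nil.
rewrite big_cons (_ : (fun _ => _) = fun y => F a y + \sum_(i <- r) F i y).
  exact: is_pderivD.
by apply/funext => y; rewrite big_cons.
Qed.

Lemma is_pderiv_plane_wave j xi x :
  is_pderiv j (plane_wave xi) x ('i * (xi 0 j)%:C * plane_wave xi x).
Proof.
have H : is_pderiv j (fun y => (dotv y xi)%:C) x (xi 0 j)%:C.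
  rewrite (_ : (fun y => _) = fun y : V => \sum_i (y 0 i)%:C * (xi 0 i)%:C); last first.
    by apply/funext => y; rewrite rmorph_sum; apply: eq_bigr => i _; rewrite rmorphM.
  apply: is_pderiv_eq (is_pderiv_sum _ (fun i => is_pderivM (is_pderiv_coord i j x) (is_pderiv_cst j _ x))) _.
  rewrite (bigD1 j) //= eqxx mulr0 mul1r addr0 big1 ?addr0 // => i /negPf ->.
  by rewrite mulr0 mul0r addr0.
apply: is_pderiv_eq (is_pderiv_cexp (is_pderivM (is_pderiv_cst j 'i x) H)) _.
by rewrite mul0r add0r.
Qed.

Lemma is_pderiv_horner (p : {poly C}) j x :
  is_pderiv j (fun y => p.[(y 0 ord_max)%:C]) x
    (p^`().[(x 0 ord_max)%:C] * (ord_max == j)%:R).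
Proof.
elim/poly_ind: p => [|p c IH].
  rewrite deriv0 horner0 mul0r (_ : (fun y => _) = fun=> 0); first exact: is_pderiv_cst.
  by apply/funext => y; rewrite horner0.
rewrite (_ : (fun y => _) = fun y : V => p.[(y 0 ord_max)%:C] * (y 0 ord_max)%:C + c); last first.
  by apply/funext => y; rewrite !hornerE.
apply: is_pderiv_eq (is_pderivD (is_pderivM IH (is_pderiv_coord _ _ _)) (is_pderiv_cst _ _ _)) _.
by rewrite derivD derivM derivX derivC !hornerE; ring.
Qed.

Lemma is_pderiv_pw (p : {poly C}) j xi x :
  is_pderiv j (fun y => p.[(y 0 ord_max)%:C] * plane_wave xi y) x
   ((p^`() * ((ord_max == j)%:R)%:P + p * ('i * (xi 0 j)%:C)%:P).[(x 0 ord_max)%:C] * plane_wave xi x).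
Proof.
apply: is_pderiv_eq (is_pderivM (is_pderiv_horner _ _ _) (is_pderiv_plane_wave _ _ _)) _.
by rewrite !(hornerD, hornerM, hornerC); ring.
Qed.


Definition Dpw xi j (p : {poly C}) : {poly C} :=
  p^`() * ((ord_max == j)%:R)%:P + p * ('i * (xi 0 j)%:C)%:P.

Lemma pderiv_pw (p : {poly C}) j xi :
  pderiv j (fun y => p.[(y 0 ord_max)%:C] * plane_wave xi y) =
  fun x => (Dpw xi j p).[(x 0 ord_max)%:C] * plane_wave xi x.
Proof. by apply/funext => x; apply: is_pderivE; exact: is_pderiv_pw. Qed.

Definition Epw xi (mu : C) (p : {poly C}) : {poly C} :=
  'X * (\sum_j Dpw xi j (Dpw xi j p))
  + (2 * mu - m.+1%:R + 2)%:P * Dpw xi ord_max p.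

Lemma juhlE_pw (p : {poly C}) mu xi :
  juhlE mu (fun y => p.[(y 0 ord_max)%:C] * plane_wave xi y) =
  fun x => (Epw xi mu p).[(x 0 ord_max)%:C] * plane_wave xi x.
Proof.
apply/funext => x; rewrite /juhlE /laplacian.
under eq_bigr do rewrite !pderiv_pw.
rewrite pderiv_pw -mulr_suml /Epw [in RHS]hornerD [in RHS]hornerM [in RHS]hornerM hornerX [in RHS]hornerC [in RHS]horner_sum; move: (\sum_i _) => s; move: (Dpw _ _ _).[_] => t; move: (m.+1%:R) => N; ring.
Qed.

Local Notation cmpoly := (mpoly.mpoly m.+1 C).
Local Notation ev xi := (mpoly.meval (fun i => (xi 0 i)%:C)).
Let XX j : cmpoly := mpoly.mpolyX C (mpoly.mnm1 j).
Let KK (c : C) : cmpoly := mpoly.mpolyC m.+1 c.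

Definition Dm j (p : {poly cmpoly}) : {poly cmpoly} :=
  p^`() * ((ord_max == j)%:R)%:P + p * (KK 'i * XX j)%:P.

Definition Em (mu : C) (p : {poly cmpoly}) : {poly cmpoly} :=
  'X * (\sum_j Dm j (Dm j p)) + (KK (2 * mu - m.+1%:R + 2))%:P * Dm ord_max p.

Lemma DmE xi j p : map_poly (ev xi) (Dm j p) = Dpw xi j (map_poly (ev xi) p).
Proof.
rewrite /Dm /Dpw rmorphD /= !rmorphM /= -deriv_map !map_polyC /= rmorph_nat.
by rewrite mpoly.mevalC mpoly.mevalXU.
Qed.

Lemma EmE xi mu p : map_poly (ev xi) (Em mu p) = Epw xi mu (map_poly (ev xi) p).
Proof.
rewrite /Em /Epw rmorphD /= !rmorphM /= map_polyX map_polyC /= mpoly.mevalC DmE rmorph_sum /=.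
by under eq_bigr do rewrite !DmE.
Qed.

Lemma juhlE_iter_pw (lambda : C) k : exists P : {poly cmpoly}, forall xi,
  juhlE_iter lambda k (plane_wave xi) =
  fun x => (map_poly (ev xi) P).[(x 0 ord_max)%:C] * plane_wave xi x.
Proof.
elim: k => [|k [P IH]] /=.
  exists 1 => xi; apply/funext => x; by rewrite rmorph1 hornerC mul1r.
by exists (Em (lambda + k%:R) P) => xi; rewrite IH juhlE_pw EmE.
Qed.

Lemma juhl_symbol_ex lambda k :
  exists p : cmpoly, is_juhl_symbol lambda k p.
Proof.
have [P H] := juhlE_iter_pw lambda k.
exists P`_0 => xi x'; rewrite /juhlJ /res H /hincl !mxE unlift_none /=.
rewrite horner_coef0 coef_map; congr (_ * cexp ('i * (_)%:C)).
rewrite /dotv (bigD1_ord ord_max) //= !mxE unlift_none mul0r add0r.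
by apply: eq_bigr => i _; rewrite !mxE liftK.
Qed.


Definition sqn (x : V) : R := \sum_i x 0 i ^+ 2.
Definition pw (a : C) (x : V) : C := cexp (a * (ln (sqn x))%:C).

Lemma sqn_gt0 x : x != 0 -> 0 < sqn x.
Proof.
move=> x0; rewrite lt_def sumr_ge0 ?andbT; last by move=> i _; exact: sqr_ge0.
apply: contra x0 => /eqP /psumr_eq0P h; apply/eqP/rowP => i; rewrite mxE.
by apply/eqP; rewrite -sqrf_eq0; apply/eqP/h => // k _; exact: sqr_ge0.
Qed.

Lemma cexpD (y z : C) : cexp (y + z) = cexp y * cexp z.
Proof.
case: y z => [a b] [c d]; rewrite /cexp /= expRD cosD sinD.
by apply/eqP; rewrite eq_complex /=; apply/andP; split; apply/eqP; ring.
Qed.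

Lemma pwS a x : x != 0 -> pw (a + 1) x = (sqn x)%:C * pw a x.
Proof.
move=> x0; rewrite /pw mulrDl mul1r cexpD mulrC; congr (_ * _).
by rewrite /cexp /= sin0 cos0 mulr1 mulr0 lnK // posrE sqn_gt0.
Qed.

Lemma cpow_eucl a x : x != 0 -> cpow (eucl_norm x) (2 * a) = pw a x.
Proof.
move=> x0; have s0 := sqn_gt0 x0; rewrite /cpow /pw /eucl_norm -/(sqn x).
rewrite -{2}(sqr_sqrtr (ltW s0)) lnXn ?sqrtr_gt0 // rmorphMn /=.
by congr cexp; rewrite -mulr_natl; ring.
Qed.

Lemma is_derive_sqn j x : is_derive x (delta_mx 0 j : V) sqn (2 * x 0 j).
Proof.
have h i := is_deriveM (is_derive_coord i j x) (is_derive_coord i j x).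
have := is_derive_sum h.
rewrite (_ : \sum_(_ < _) _ = sqn); last first.
  by apply/funext => y; rewrite fct_sumE; apply: eq_bigr => i _; rewrite expr2.
rewrite (bigD1 j) //= eqxx big1 ?addr0; last first.
  by move=> i /negPf ->; rewrite !scaler0 addr0.
by move=> H; apply: is_derive_eq; rewrite /GRing.scale /= !mulr1 mulr2n mulrDl !mul1r.
Qed.

Lemma is_pderiv_pow a j x : x != 0 ->
  is_pderiv j (pw (a + 1)) x (2 * (a + 1) * (x 0 j)%:C * pw a x).
Proof.
move=> x0; have s0 := sqn_gt0 x0.
have h1 := is_derive_comp1 (is_derive1_ln s0) (is_derive_sqn j x).
apply: is_pderiv_eq (is_pderiv_cexp (is_pderivM (is_pderiv_cst j (a + 1) x) (is_pderiv_real h1))) _.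
rewrite -/(pw _ _) pwS // mul0r add0r rmorphM fmorphV rmorphM /= rmorph_nat.
have : (sqn x)%:C != 0 by rewrite fmorph_eq0 gt_eqF.
move: (sqn x)%:C => s ns; field; exact: ns.
Qed.

Lemma is_pderiv_mpoly j (Q : cmpoly) : exists Q' : cmpoly,
  forall x, is_pderiv j (fun y => ev y Q) x (ev x Q').
Proof.
pose P (Q : cmpoly) := exists Q' : cmpoly,
  forall x, is_pderiv j (fun y => ev y Q) x (ev x Q').
have PC c : P (KK c).
  exists 0 => x; rewrite meval0 (_ : (fun _ => _) = fun=> c); first exact: is_pderiv_cst.
  by apply/funext => y; rewrite mevalC.
have PM q1 q2 : P q1 -> P q2 -> P (q1 * q2).
  move=> [r1 h1] [r2 h2]; exists (r1 * q2 + q1 * r2) => x.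
  rewrite mevalD !mevalM (_ : (fun _ => _) = fun y : V => ev y q1 * ev y q2).
    exact: is_pderivM.
  by apply/funext => y; rewrite mevalM.
have PD q1 q2 : P q1 -> P q2 -> P (q1 + q2).
  move=> [r1 h1] [r2 h2]; exists (r1 + r2) => x.
  rewrite mevalD (_ : (fun _ => _) = fun y : V => ev y q1 + ev y q2).
    exact: is_pderivD.
  by apply/funext => y; rewrite mevalD.
have PX i : P (XX i).
  exists (KK (i == j)%:R) => x; rewrite mevalC.
  rewrite (_ : (fun _ => _) = fun y : V => (y 0 i)%:C); first exact: is_pderiv_coord.
  by apply/funext => y; rewrite mevalXU.
rewrite -/(P Q) (mpolyE Q); apply: (big_ind P); [by rewrite -mpolyC0; exact: PC|exact: PD|].
move=> mm _; rewrite -mul_mpolyC; apply: (PM); first exact: PC.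
rewrite mpolyXE_id; apply: (big_ind P); [by rewrite -mpolyC1; exact: PC|exact: PM|].
move=> i _; elim: (mm i) => [|e IH]; first by rewrite expr0 -mpolyC1; exact: PC.
by rewrite exprS; apply: (PM) => //; exact: PX.
Qed.

Lemma is_pderiv_mpow j (Q : cmpoly) a : exists Q' : cmpoly, forall x, x != 0 ->
  is_pderiv j (fun y => ev y Q * pw (a + 1) y) x (ev x Q' * pw a x).
Proof.
have [r h] := is_pderiv_mpoly j Q.
exists (r * (\sum_i XX i ^+ 2) + Q * (KK (2 * (a + 1)) * XX j)) => x x0.
apply: is_pderiv_eq (is_pderivM (h x) (is_pderiv_pow a j x0)) _.
rewrite pwS // mevalD !mevalM mevalC mevalXU.
rewrite (_ : ev x (\sum_i XX i ^+ 2) = (sqn x)%:C); first by ring.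
rewrite [LHS]rmorph_sum /sqn [RHS]rmorph_sum /=; apply: eq_bigr => i _.
by rewrite [LHS]rmorphXn [RHS]rmorphXn /= mevalXU.
Qed.

Lemma iter_pderiv j k : forall (Q : cmpoly) a, exists Q' : cmpoly, forall f,
  (forall x, x != 0 -> f x = ev x Q * pw (a + k%:R) x) ->
  forall x, x != 0 -> iter k (pderiv j) f x = ev x Q' * pw a x.
Proof.
elim: k => [|k IH] Q a; first by exists Q => f h x x0; rewrite /= h // addr0.
have [Q1 h1] := is_pderiv_mpow j Q (a + k%:R).
have [Q2 h2] := IH Q1 a.
exists Q2 => f h x x0; rewrite iterSr; apply: h2 => // {}x {}x0.
apply: is_pderivE; apply: is_pderiv_near (h1 x x0).
have : \near x, x != 0.
  have o : open (~` [set (0 : V)]).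
    apply: closed_openC; apply: accessible_closed_set1; apply: hausdorff_accessible.
    exact: norm_hausdorff.
  have : nbhs x (~` [set (0 : V)]) by apply: open_nbhs_nbhs; split => //; exact/eqP.
  by apply: filterS => y /eqP.
by apply: filterS => y y0; rewrite h // -natr1 addrA.
Qed.

Lemma Bpoly_ex gamma k : exists p : cmpoly, is_Bpoly gamma k p.
Proof.
have [Q h] := iter_pderiv ord_max k 1 gamma.
exists Q => x x0; rewrite cpow_eucl //; apply: h => // y y0.
by rewrite cpow_eucl // meval1 mul1r.
Qed.

End Facts.


Section Uniq.
Variable R : realType.
Local Notation C := R[i].

Lemma mcoeff_muni n (p : mpoly n.+1 C) (mm : multinom n.+1) :
  muni p = 0 -> mcoeff mm p = 0.
Proof.
have [|/memN_msupp_eq0 //] := boolP (mm \in msupp p) => mmp.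
rewrite muniE => h; move: (h).
rewrite (bigD1_seq mm) ?msupp_uniq //=.
set r := Multinom _ => /(congr1 (fun q : {poly mpoly n C} => mcoeff r q`_(mm ord_max))).
rewrite coefD !coefZ coefXn eqxx mulr1 coef0 mcoeff0 mcoeffD mcoeffZ mcoeffX eqxx mulr1.
rewrite coef_sum raddf_sum /= big1 ?addr0 // => k kmm.
rewrite !coefZ coefXn.
have [e|_] := eqVneq (mm ord_max) (k ord_max); last by rewrite mulr0 mcoeff0.
rewrite mulr1 mcoeffZ mcoeffX.
have [e2|_] := eqVneq _ r; last by rewrite mulr0.
case/negP: kmm; apply/eqP/mnmP => i.
have [j ->|->] := unliftP ord_max i; last by [].
have -> : lift ord_max j = widen_ord (leqnSn n) j.
  by apply/val_inj; rewrite /= /bump leqNgt ltn_ord.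
by have /mnmP/(_ j) := e2; rewrite !mnmE.
Qed.

Lemma meval_muni n (p : mpoly n.+1 C) (v : 'I_n.+1 -> C) :
  meval v p = (map_poly (meval (fun i => v (widen_ord (leqnSn n) i))) (muni p)).[v ord_max].
Proof.
rewrite muniE mevalE raddf_sum /= horner_sum; apply: eq_bigr => k _.
rewrite -[X in map_poly _ X]mul_polyC rmorphM /= map_polyC map_polyXn hornerM hornerC hornerXn /=.
rewrite mevalZ mevalX big_ord_recr /= mulrA; congr (_ * _ * _).
by apply: eq_bigr => i _; rewrite mnmE.
Qed.

Lemma meval_real_eq0 n (p : mpoly n C) :
  (forall v : 'I_n -> R, meval (fun i => (v i)%:C) p = 0) -> p = 0.
Proof.
elim: n p => [|n IH] p hp.
  by have := hp (fun=> 0); rewrite (nvar0_mpolyC p) mevalC => ->.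
apply/mpolyP => mm; rewrite mcoeff0; apply: mcoeff_muni.
apply/polyP => k; rewrite coef0; apply: IH => v.
suff /polyP/(_ k) : map_poly (meval (fun i => (v i)%:C)) (muni p) = 0.
  by rewrite coef_map coef0.
set q := map_poly _ _.
have hq (t : R) : q.[t%:C] = 0.
  have := hp (fun i => if unlift ord_max i is Some j then v j else t).
  rewrite meval_muni unlift_none => <-; congr (_.[_]).
  rewrite /q; congr (map_poly (meval _) _); apply/funext => i.
  have -> : widen_ord (leqnSn n) i = lift ord_max i.
    by apply/val_inj; rewrite /= /bump leqNgt ltn_ord.
  by rewrite liftK.
apply/eqP/negPn/negP => q0.
have := max_poly_roots q0 (rs := [seq (i%:R : R)%:C | i <- iota 0 (size q)]).
rewrite size_map size_iota ltnn => h; suff : false by []; apply: h.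
  by apply/allP => _ /mapP[i _ ->]; apply/rootP.
rewrite map_inj_uniq ?iota_uniq // => i j /complexI /eqP.
by rewrite eqr_nat => /eqP.
Qed.
End Uniq.

Section WellDefined.
Variables (R : realType) (m : nat).
Implicit Types (z : R[i]) (p : mpoly m.+1 R[i]).

Lemma juhl_symbolP z k : is_juhl_symbol z k (juhl_symbol m z k).
Proof. exact: (xgetPex _ (juhl_symbol_ex m z k)). Qed.

Lemma BpolyP z k : is_Bpoly z k (Bpoly m z k).
Proof. exact: (xgetPex _ (Bpoly_ex m z k)). Qed.

Lemma cexp_neq0 z : cexp z != 0.
Proof.
apply/eqP => e; have := cexpD z (- z); rewrite e mul0r subrr => /eqP.
by rewrite eq_complex /= expR0 cos0 mulr1 oner_eq0.
Qed.

Lemma meval_real_inj p q :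
  (forall x : 'rV[R]_m.+1, x != 0 ->
    meval (fun i => (x 0 i)%:C) p = meval (fun i => (x 0 i)%:C) q) -> p = q.
Proof.
move=> h; apply/eqP; rewrite -subr_eq0.
pose X : mpoly m.+1 R[i] := mpolyX _ (mnm1 ord_max).
have : (p - q) * X = 0.
  apply: meval_real_eq0 => v; rewrite mevalM mevalB mevalXU.
  have [v0|v0] := eqVneq (v ord_max) 0; first by rewrite v0 mulr0.
  have := h (\row_i v i); rewrite (_ : (fun i => _) = fun i => (v i)%:C).
    move=> ->; first by rewrite subrr mul0r.
    by apply: contra v0 => /eqP/rowP/(_ ord_max); rewrite !mxE => ->.
  by apply/funext => i; rewrite mxE.
move/eqP; rewrite mulf_eq0 => /orP[//|/eqP X0].
have := congr1 (meval (fun=> 1)) X0; rewrite mevalXU meval0 => /eqP.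
by rewrite oner_eq0.
Qed.

Lemma juhl_symbol_uniq z k p : is_juhl_symbol z k p -> p = juhl_symbol m z k.
Proof.
move=> hp; apply: meval_real_inj => x _.
have := hp x 0; rewrite (juhl_symbolP z k) => /(mulIf _) -> //.
exact: cexp_neq0.
Qed.

Lemma Bpoly_uniq z k p : is_Bpoly z k p -> p = Bpoly m z k.
Proof.
move=> hp; apply: meval_real_inj => x x0.
have := hp x x0; rewrite (BpolyP z k) // => /(mulIf _) -> //.
exact: cexp_neq0.
Qed.

End WellDefined.

(* Main.v *)
Require Import Defs.
From mathcomp Require Import all_boot all_order all_algebra.
From mathcomp Require Import all_classical all_reals all_analysis.
From mathcomp Require Import complex.
From mathcomp Require Import -(notations) mpoly.
From mathcomp Require Import ring.
Import GRing.Theory Num.Theory.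
Import numFieldNormedType.Exports.
Local Open Scope ring_scope.
Local Open Scope complex_scope.

(** Both families of polynomials obey the same first-order recursion in [k], up
    to a factor ['i]. Write n = m.+1, gamma = lambda - n / 2, and d_n for the
    derivative in xi_n.

    On the B side, differentiate
      d_n ^ k |xi| ^ (2 (gamma + 1 + k)) = B_k ^ (gamma + 1) |xi| ^ (2 (gamma + 1))
    once more:
      B_(k+1) ^ gamma
        = |xi| ^ 2 d_n B_k ^ (gamma + 1) + 2 (gamma + 1) xi_n B_k ^ (gamma + 1).
    This is [Brec], and [Brec_is_Bpoly] is the computation. The recursion also
    shows that B_k is homogeneous of degree k ([dhomog_Brec]), so that
    B_k ('i xi) = 'i ^ k B_k (xi).

    On the Juhl side, let J be the composite of res with the last k factors, so
    that J has symbol j = j^(k)_(lambda+1) and J^(k+1)_lambda = J o E_lambda.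
    With c = 2 lambda - n + 2 = 2 (gamma + 1),
      E_lambda e^(i x.xi) = (- |xi| ^ 2 x_n + c 'i xi_n) e^(i x.xi).
    Multiplying a plane wave by 'i x_n is the same as differentiating it in
    xi_n, and d_n commutes with J, which acts in x only; hence J sends
    'i x_n e^(i x.xi) to (d_n j) e^(i x'.xi'), and
      j^(k+1)_lambda = 'i (|xi| ^ 2 d_n j + c xi_n j).
    Induction on k then gives j^(k)_lambda = 'i ^ k B_k ^ gamma
    ([Em_iter1_Brec]).

    The exchange of d_n and J is carried out algebraically. The operators are
    applied to p(x_n) e^(i x.xi), where p has coefficients polynomial in xi, and
    act on p through [Em]. There d_n becomes [xideriv], which commutes with
    every [Em] because it commutes with each partial derivative in x and with
    multiplication by x_n ([xideriv_Em]). *)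

(** * The B polynomials *)

Section BPolynomials.
Variables (R : realType) (m : nat).
Local Notation C := R[i].
Local Notation V := 'rV[R]_m.+1.
Local Notation cmpoly := (mpoly m.+1 C).
Local Notation ev xi := (meval (fun i => (xi 0 i)%:C)).
Local Notation X j := (mpolyX C (mnm1 j)).

Lemma mderivU (i j : 'I_m.+1) : mderiv j (X i : cmpoly) = (i == j)%:R.
Proof.
rewrite mderivX mnm1E; case: eqVneq => [->|_]; last by rewrite scale0r.
rewrite scale1r (_ : mnm_sub _ _ = mnm0) ?mpolyX0 //.
by apply/mnmP => l; rewrite mnmBE subnn mnm0E.
Qed.

(** The analytic partial derivative of a polynomial function is the formal one;
    this gives the derivative in closed form, so that it can enter a recursion. *)
Lemma is_pderiv_meval (j : 'I_m.+1) (Q : cmpoly) (x : V) :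
  is_pderiv j (fun y => ev y Q) x (ev x (mderiv j Q)).
Proof.
pose P (Q : cmpoly) :=
  is_pderiv j (fun y : V => ev y Q) x (ev x (mderiv j Q)).
have PC c : P (mpolyC m.+1 c).
  rewrite /P mderivC meval0 (_ : (fun _ => _) = fun=> c).
    exact: is_pderiv_cst.
  by apply/funext => y; rewrite mevalC.
have PM q1 q2 : P q1 -> P q2 -> P (q1 * q2).
  move=> h1 h2; rewrite /P mderivM mevalD !mevalM.
  rewrite (_ : (fun _ => _) = fun y : V => ev y q1 * ev y q2).
    exact: is_pderivM.
  by apply/funext => y; rewrite mevalM.
have PD q1 q2 : P q1 -> P q2 -> P (q1 + q2).
  move=> h1 h2; rewrite /P mderivD mevalD.
  rewrite (_ : (fun _ => _) = fun y : V => ev y q1 + ev y q2).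
    exact: is_pderivD.
  by apply/funext => y; rewrite mevalD.
have PX i : P (X i).
  rewrite /P (_ : (fun _ => _) = fun y : V => (y 0 i)%:C); last first.
    by apply/funext => y; rewrite mevalXU.
  apply: is_pderiv_eq; first exact: is_pderiv_coord.
  by rewrite mderivU rmorph_nat.
rewrite -/(P Q) (mpolyE Q); apply: (big_ind P) => //.
  by rewrite -mpolyC0; exact: PC.
move=> mm _; rewrite -mul_mpolyC; apply: (PM); first exact: PC.
rewrite mpolyXE_id; apply: (big_ind P) => //.
  by rewrite -mpolyC1; exact: PC.
move=> i _; elim: (mm i) => [|e IH].
  by rewrite expr0 -mpolyC1; exact: PC.
by rewrite exprS; apply: (PM).
Qed.

Definition msqn : cmpoly := \sum_i X i ^+ 2.

Lemma meval_msqn (x : V) : ev x msqn = (sqn x)%:C.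
Proof.
rewrite [LHS]rmorph_sum /sqn [RHS]rmorph_sum /=; apply: eq_bigr => i _.
by rewrite [LHS]rmorphXn [RHS]rmorphXn /= mevalXU.
Qed.

(** The explicit form of B_k^gamma: the step is the product rule applied to
    B_k^(gamma+1) |xi|^(2 (gamma+1)), divided by |xi|^(2 gamma). *)
Fixpoint Brec (gamma : C) (k : nat) : cmpoly :=
  if k is k'.+1 then
    msqn * mderiv ord_max (Brec (gamma + 1) k')
    + mpolyC m.+1 (2 * (gamma + 1)) * X ord_max * Brec (gamma + 1) k'
  else 1.

(** The last of the k+1 derivatives falls on a function which the induction
    hypothesis, at gamma + 1, describes only off the origin. That is enough,
    since a derivative depends only on a neighborhood of the point. *)
Lemma Brec_is_Bpoly (k : nat) (gamma : C) : is_Bpoly gamma k (Brec gamma k).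
Proof.
elim: k gamma => [|k IH] gamma xi xi0.
  by rewrite addr0 /= meval1 mul1r.
rewrite iterS cpow_eucl //; apply: is_pderivE.
have near0 : \near xi, xi != 0.
  have o : open (~` [set (0 : V)])%classic.
    apply: closed_openC; apply: accessible_closed_set1.
    by apply: hausdorff_accessible; exact: norm_hausdorff.
  have : nbhs xi (~` [set (0 : V)])%classic.
    by apply: open_nbhs_nbhs; split => //; exact/eqP.
  by apply: filterS => y /eqP.
apply: (@is_pderiv_near _ _ _
  (fun y => ev y (Brec (gamma + 1) k) * pw (gamma + 1) y)).
  apply: filterS near0 => y y0.
  rewrite -cpow_eucl // -IH //; congr (iter k _ _ _); apply/funext => z.
  by rewrite -natr1; congr (cpow _ (2 * _)); ring.
apply: is_pderiv_eq.
  exact: (is_pderivM (is_pderiv_meval _ _ _) (is_pderiv_pow gamma ord_max xi0)).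
rewrite /= pwS // mevalD !mevalM mevalC mevalXU meval_msqn; ring.
Qed.

(** In degree 0 the truncated predecessor is harmless: constants have
    derivative 0, which is homogeneous of every degree. *)
Lemma dhomog_mderiv d (j : 'I_m.+1) (Q : cmpoly) :
  Q \is ishomog1 d (@mdeg m.+1) -> mderiv j Q \is ishomog1 d.-1 (@mdeg m.+1).
Proof.
move=> /dhomogP hQ; apply/dhomogP => mm; rewrite mcoeff_msupp mcoeff_mderiv.
move=> h; have : mnm_add mm (mnm1 j) \in msupp Q.
  by rewrite mcoeff_msupp; apply: contraNneq h => ->; rewrite mul0rn.
by move/hQ => /= <-; rewrite mdegD mdeg1 addn1.
Qed.

Lemma dhomog_Brec k gamma : Brec gamma k \is ishomog1 k (@mdeg m.+1).
Proof.
elim: k gamma => [|k IH] gamma /=; first exact: dhomog1.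
have hX i : X i \is ishomog1 1 (@mdeg m.+1) by rewrite dhomogX /= mdeg1.
apply: dhomogD; last first.
  rewrite -mulrA mul_mpolyC; apply: dhomogZ.
  by rewrite -[k.+1]add1n; apply: dhomogM.
(* For k = 0 the degree 2 + k.-1 of the product is not k.+1; there the
   derivative vanishes. *)
case: k IH => [|k] IH.
  by rewrite /= -mpolyC1 mderivC mulr0 dhomog0.
rewrite (_ : k.+2 = (2 + k.+1.-1)%N) //; apply: dhomogM.
  by apply: rpred_sum => i _; exact: (@dhomogMn _ _ _ 1 _ 2).
exact: dhomog_mderiv.
Qed.

Lemma meval_dhomog d (Q : cmpoly) (a : C) (v : 'I_m.+1 -> C) :
  Q \is ishomog1 d (@mdeg m.+1) ->
  meval (fun i => a * v i) Q = a ^+ d * meval v Q.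
Proof.
move=> /dhomogP hQ; rewrite !mevalE mulr_sumr big_seq [RHS]big_seq.
apply: eq_bigr => mm /hQ /= <-.
rewrite mulrCA mdegE; congr (_ * _); rewrite -prodrXr -big_split /=.
by apply: eq_bigr => i _; rewrite exprMn.
Qed.

End BPolynomials.

(** * The Juhl operators on plane waves *)

Section JuhlSymbols.
Variables (R : realType) (m : nat).
Local Notation C := R[i].
Local Notation V := 'rV[R]_m.+1.
Local Notation cmpoly := (mpoly m.+1 C).
Local Notation ev xi := (meval (fun i => (xi 0 i)%:C)).
Local Notation X j := (mpolyX C (mnm1 j)).
Local Notation K c := (mpolyC m.+1 (c : C)).

(** The composite E_(lambda+k-1) o ... o E_lambda, read on the factor p of
    p(x_n) e^(i x.xi). *)
Fixpoint Em_iter (lambda : C) (k : nat) (p : {poly cmpoly}) : {poly cmpoly} :=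
  if k is k'.+1 then Em (lambda + k'%:R) (Em_iter lambda k' p) else p.

(** Peeling off the innermost factor E_lambda: the recursion on symbols runs from
    this side, whereas the operators are built from the outside. *)
Lemma Em_iterSr lambda k p :
  Em_iter lambda k.+1 p = Em_iter (lambda + 1) k (Em lambda p).
Proof.
elim: k => [|k IH]; first by rewrite /= addr0.
rewrite [RHS]/=.
have -> : lambda + 1 + k%:R = lambda + k.+1%:R by rewrite -natr1 addrA addrAC.
by rewrite -IH.
Qed.

Lemma juhlE_iterE lambda k (xi : V) :
  juhlE_iter lambda k (plane_wave xi) =
  fun x => (map_poly (ev xi) (Em_iter lambda k 1)).[(x 0 ord_max)%:C]
           * plane_wave xi x.
Proof.
elim: k => [|k IH] /=; last by rewrite IH juhlE_pw EmE.
by apply/funext => x; rewrite rmorph1 hornerC mul1r.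
Qed.

(** Restricting to x_n = 0 keeps only the constant coefficient. *)
Lemma Em_iter_is_juhl_symbol lambda k :
  is_juhl_symbol lambda k (Em_iter lambda k 1)`_0.
Proof.
move=> xi x'; rewrite /juhlJ /res juhlE_iterE /hincl !mxE unlift_none /=.
rewrite horner_coef0 coef_map; congr (_ * cexp ('i * (_)%:C)).
rewrite /dotv (bigD1_ord ord_max) //= !mxE unlift_none mul0r add0r.
by apply: eq_bigr => i _; rewrite !mxE liftK.
Qed.

(** * Differentiation in the frequency *)

Lemma DmD j (p q : {poly cmpoly}) : Dm j (p + q) = Dm j p + Dm j q.
Proof. by rewrite /Dm /= derivD; ring. Qed.

Lemma DmCM j a (p : {poly cmpoly}) : Dm j (a%:P * p) = a%:P * Dm j p.
Proof. by rewrite /Dm /= derivM derivC; ring. Qed.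

Lemma EmD mu (p q : {poly cmpoly}) : Em mu (p + q) = Em mu p + Em mu q.
Proof.
rewrite /Em /=.
under eq_bigr => j _ do rewrite (DmD j p q) (DmD j (Dm j p)).
by rewrite big_split DmD /= !(mulrDr 'X) mulrDr addrACA.
Qed.

Lemma EmCM mu a (p : {poly cmpoly}) : Em mu (a%:P * p) = a%:P * Em mu p.
Proof.
rewrite /Em /=.
under eq_bigr => j _ do rewrite (DmCM j a p) (DmCM j a (Dm j p)).
by rewrite -mulr_sumr (DmCM ord_max a p) mulrCA [t in _ + t = _]mulrCA -mulrDr.
Qed.

Lemma Em_iterD lambda k (p q : {poly cmpoly}) :
  Em_iter lambda k (p + q) = Em_iter lambda k p + Em_iter lambda k q.
Proof. by elim: k => //= k ->; rewrite EmD. Qed.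

Lemma Em_iterCM lambda k a (p : {poly cmpoly}) :
  Em_iter lambda k (a%:P * p) = a%:P * Em_iter lambda k p.
Proof. by elim: k => //= k ->; rewrite EmCM. Qed.

(** The derivative in xi_n of p(x_n, xi) e^(i x.xi), read on the factor p: the
    second summand comes from differentiating the exponential. *)
Definition xideriv (p : {poly cmpoly}) : {poly cmpoly} :=
  map_poly (mderiv ord_max) p + (K 'i%C)%:P * 'X * p.

Lemma map_mderivM j (p q : {poly cmpoly}) :
  map_poly (mderiv j) (p * q) =
  map_poly (mderiv j) p * q + p * map_poly (mderiv j) q.
Proof.
apply/polyP => i; rewrite coefD coef_map !coefM raddf_sum -big_split /=.
by apply: eq_bigr => l _; rewrite !coef_map mderivM.
Qed.

Lemma map_mderivX j : map_poly (mderiv j) ('X : {poly cmpoly}) = 0.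
Proof.
apply/polyP => i; rewrite coef_map coefX coef0.
by case: eqP => _; rewrite /= ?mderiv0 // -mpolyC1 mderivC.
Qed.

Lemma xiderivD (p q : {poly cmpoly}) :
  xideriv (p + q) = xideriv p + xideriv q.
Proof. by rewrite /xideriv raddfD /=; ring. Qed.

Lemma xiderivXM (p : {poly cmpoly}) : xideriv ('X * p) = 'X * xideriv p.
Proof. by rewrite /xideriv map_mderivM map_mderivX; ring. Qed.

Lemma xiderivCM c (p : {poly cmpoly}) :
  xideriv ((K c)%:P * p) = (K c)%:P * xideriv p.
Proof. by rewrite /xideriv map_mderivM map_polyC /= mderivC; ring. Qed.

(** Derivatives in x_j and in xi_n of p(x_n, xi) e^(i x.xi) commute. When x_j is
    x_n, the extra term 'i p appears on both sides: on the left from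
    differentiating the factor 'i xi_n, on the right from the factor 'i x_n. *)
Lemma xideriv_Dm j (p : {poly cmpoly}) : xideriv (Dm j p) = Dm j (xideriv p).
Proof.
have xM q (a : cmpoly) :
    xideriv (q * a%:P) = xideriv q * a%:P + q * (mderiv ord_max a)%:P.
  by rewrite /xideriv map_mderivM map_polyC /=; ring.
have xd : (xideriv p)^`() = xideriv p^`() + (K 'i%C)%:P * p.
  have dd : (map_poly (mderiv ord_max) p)^`() = map_poly (mderiv ord_max) p^`().
    by apply/polyP => i; rewrite !(coef_map, coef_deriv) raddfMn.
  by rewrite /xideriv derivD dd !derivM derivX derivC; ring.
have dn (n : nat) : mderiv ord_max (n%:R : cmpoly) = 0.
  by rewrite raddfMn -mpolyC1 /= mderivC mul0rn.
rewrite /Dm /= xiderivD [t in t + _ = _]xM [t in _ + t = _]xM xd.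
rewrite mderivM mderivC mderivU (dn (ord_max == j)) [j == _]eq_sym.
rewrite polyC0 mul0r add0r !polyCM; ring.
Qed.

Lemma xideriv_Em mu (p : {poly cmpoly}) : xideriv (Em mu p) = Em mu (xideriv p).
Proof.
rewrite /Em /= xiderivD xiderivXM xiderivCM xideriv_Dm; congr ('X * _ + _).
have x0 : xideriv 0 = 0 by rewrite /xideriv raddf0 mulr0 addr0.
rewrite (big_morph xideriv xiderivD x0).
by apply: eq_bigr => j _; rewrite !xideriv_Dm.
Qed.

Lemma xideriv_Em_iter lambda k (p : {poly cmpoly}) :
  xideriv (Em_iter lambda k p) = Em_iter lambda k (xideriv p).
Proof. by elim: k => //= k <-; rewrite xideriv_Em. Qed.

(** Differentiating the symbol in xi_n amounts to inserting 'i x_n before the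
    operator: [xideriv] sends 1 to 'i x_n, it passes through the operators, and
    at x_n = 0 it reduces to the derivative of the coefficient. *)
Lemma mderiv_Em_iter1 lambda k :
  mderiv ord_max (Em_iter lambda k 1)`_0 = K 'i%C * (Em_iter lambda k 'X)`_0.
Proof.
have := congr1 (fun p : {poly cmpoly} => p`_0) (xideriv_Em_iter lambda k 1).
rewrite {2}/xideriv -polyC1 map_polyC /= -{1}mpolyC1 mderivC add0r polyC1 mulr1.
rewrite Em_iterCM coefCM => <-.
by rewrite /xideriv coefD coef_map -mulrA coefCM coefXM eqxx mulr0 addr0.
Qed.

(** * The recursion of the symbols *)

Lemma mpolyC_i_sq : K 'i%C * K 'i%C = -1.
Proof. by rewrite -mpolyCM -expr2 sqr_i mpolyCN mpolyC1. Qed.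

(** The first step E_mu e^(i x.xi) = (- |xi|^2 x_n + c 'i xi_n) e^(i x.xi). The
    trailing factor 1 lets the linearity of [Em_iter] over polynomials in xi
    apply to both summands. *)
Lemma Em1 mu :
  Em mu 1 = (- msqn R m)%:P * 'X
          + (K (2 * mu - m.+1%:R + 2) * (K 'i%C * X ord_max))%:P * 1.
Proof.
have D1 j : Dm j (1 : {poly cmpoly}) = (K 'i%C * X j)%:P.
  by rewrite /Dm /= -polyC1 derivC; ring.
have D2 j : Dm j (Dm j (1 : {poly cmpoly})) = (- X j ^+ 2)%:P.
  rewrite D1 /Dm /= derivC mul0r add0r -polyCM; congr polyC.
  by rewrite mulrACA mpolyC_i_sq; ring.
rewrite /Em /=; under eq_bigr do rewrite D2.
by rewrite D1 -raddf_sum /= sumrN -/(msqn R m) !polyCM; ring.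
Qed.

(** The recursion of the symbols. The sign of - |xi|^2 is absorbed by
    x_n = - 'i ('i x_n). *)
Lemma Em_iter1S lambda k :
  (Em_iter lambda k.+1 1)`_0 =
  K 'i%C * (msqn R m * mderiv ord_max (Em_iter (lambda + 1) k 1)`_0
     + K (2 * lambda - m.+1%:R + 2) * X ord_max
       * (Em_iter (lambda + 1) k 1)`_0).
Proof.
rewrite Em_iterSr Em1 Em_iterD !Em_iterCM coefD !coefCM mderiv_Em_iter1.
rewrite mulrDr [K 'i%C * (_ * (_ * _))]mulrCA
  [K 'i%C * (K 'i%C * _)]mulrA mpolyC_i_sq.
by move: (Em_iter _ _ _)`_0 (Em_iter _ _ _)`_0 => a b; ring.
Qed.

(** The two recursions agree because 2 lambda - n + 2 = 2 (gamma + 1) when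
    gamma = lambda - n / 2, and each step contributes one factor 'i. *)
Lemma Em_iter1_Brec lambda k :
  (Em_iter lambda k 1)`_0 = K ('i%C ^+ k) * Brec R m (lambda - m.+1%:R / 2) k.
Proof.
elim: k lambda => [|k IH] lambda.
  by rewrite /= coefC /= expr0 mpolyC1 mulr1.
rewrite Em_iter1S IH /= mderiv_mulC.
have -> : lambda + 1 - m.+1%:R / 2 = lambda - m.+1%:R / 2 + 1 by ring.
have -> : 2 * lambda - m.+1%:R + 2 = 2 * (lambda - m.+1%:R / 2 + 1) by field.
rewrite exprS mpolyCM; move: (Brec _ _ _ _) => b; ring.
Qed.

End JuhlSymbols.

Theorem theorem5p3 (R : realType) (m : nat) (lambda : R[i]) (k : nat)
    (xi : 'rV[R]_m.+1) :
  meval (fun j => (xi 0 j)%:C) (juhl_symbol m lambda k)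
  = meval (fun j => 'i * (xi 0 j)%:C) (Bpoly m (lambda - m.+1%:R / 2) k).
Proof.
rewrite -(juhl_symbol_uniq (Em_iter_is_juhl_symbol R m lambda k)).
rewrite -(Bpoly_uniq (Brec_is_Bpoly R m k _)) Em_iter1_Brec mevalM mevalC.
by rewrite (meval_dhomog _ _ _ _ _ _ (dhomog_Brec R m k _)).
Qed.
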